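(* Let $d=d_\delta$ be a rotation-invariant distance on $\mathcal{S}^{q-1}$, $d_\delta(\theta,\psi)=\delta(\theta'\psi)$, based on a monotone strictly decreasing function $\delta:[-1,1]\to\mathbb{R}^+$. Let $\theta_0\in\mathcal{S}^{q-1}$ and let $h:\mathbb{R}\to\mathbb{R}^+$ be a monotone strictly increasing and differentiable function such that $t\mapsto t\,\frac{d}{dt}\log h(t)$ is monotone strictly increasing. For $\kappa>0$, let $H_\kappa$ be the distribution on $\mathcal{S}^{q-1}$ admitting the density $x\mapsto c_{q,\kappa,h}\,h(\kappa x'\theta_0)$, where $c_{q,\kappa,h}$ is a normalizing constant. Then the maximal depth $\max_{\theta\in\mathcal{S}^{q-1}}D_{d_\delta}(\theta,H_\kappa)=D_{d_\delta}(\theta_0,H_\kappa)$ is a strictly increasing function of $\kappa$.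
   Context: Let $q\ge 2$ and $\mathcal{S}^{q-1}=\{x\in\mathbb{R}^q: x'x=1\}$, where $'$ denotes transpose; $\mathbb{R}^+=[0,\infty)$. Densities on $\mathcal{S}^{q-1}$ are with respect to the surface area measure. A distance $d$ on $\mathcal{S}^{q-1}$ is a metric on this set; it is rotation-invariant if $d(O\theta,O\psi)=d(\theta,\psi)$ for all $\theta,\psi\in\mathcal{S}^{q-1}$ and all $q\times q$ orthogonal matrices $O$; any such distance is of the form $d_\delta(\theta,\psi)=\delta(\theta'\psi)$ for some $\delta:[-1,1]\to\mathbb{R}^+$. For a bounded distance $d$ put $d^{\rm sup}=\sup\{d(\theta,\psi):\theta,\psi\in\mathcal{S}^{q-1}\}$. For a (Borel probability) distribution $H$ on $\mathcal{S}^{q-1}$, the directional $d$-depth of $\theta\in\mathcal{S}^{q-1}$ with respect to $H$ is $D_d(\theta,H)=d^{\rm sup}-E_H[d(\theta,W)]$, where $E_H$ is expectation when $W$ has distribution $H$. *)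

(* Defs.v *)
From HB Require Import structures.
From mathcomp Require Import all_boot all_order all_algebra.
From mathcomp Require Import all_classical all_reals all_analysis.
From mathcomp Require Import measurable_realfun lra.

Set Implicit Arguments.
Unset Strict Implicit.
Unset Printing Implicit Defensive.
Import Order.TTheory GRing.Theory Num.Theory.
Import numFieldNormedType.Exports.
Local Open Scope classical_set_scope.
Local Open Scope ring_scope.

Section inner_product.
Context {R : realType} {q : nat}.

Definition dot (x y : 'cV[R]_q) : R := (x^T *m y) 0 0.

Lemma dotE x y : dot x y = \sum_i x i 0 * y i 0.
Proof. by rewrite /dot mxE; apply: eq_bigr => i _; rewrite mxE. Qed.

Lemma dotZ a b x y : dot (a *: x) (b *: y) = a * b * dot x y.
Proof.
by rewrite !dotE mulr_sumr; apply: eq_bigr => i _; rewrite !mxE mulrACA.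
Qed.

End inner_product.

(* [sphere R n] is the unit sphere S^n of R^(n+1).  Indexing by the dimension
   of the sphere rather than of the ambient space keeps the type inhabited,
   which the library requires of a [measurableType]. *)
Record sphere (R : realType) (n : nat) := Sphere {
  sphere_val :> 'cV[R]_n.+1 ;
  sphere_valP : dot sphere_val sphere_val == 1 }.

HB.instance Definition _ R n := [isSub for @sphere_val R n].
HB.instance Definition _ R n := [Choice of sphere R n by <:].

Section sphere_structure.
Context {R : realType} {n : nat}.

Fact delta_sphere : dot (delta_mx 0 0 : 'cV[R]_n.+1) (delta_mx 0 0) == 1.
Proof.
rewrite dotE (bigD1 ord0)//= big1 => [|i /negPf i0].
  by rewrite !mxE eqxx mulr1 addr0.
by rewrite !mxE i0 mul0r.
Qed.

HB.instance Definition _ := isPointed.Build (sphere R n) (Sphere delta_sphere).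

Fact rotate_subproof (O : 'M[R]_n.+1) (OO : O^T *m O = 1%:M) (x : sphere R n) :
  dot (O *m x) (O *m x) == 1.
Proof.
rewrite /dot trmx_mul mulmxA -(mulmxA _ O^T) OO mulmx1.
exact: sphere_valP.
Qed.

Definition rotate O OO x := Sphere (@rotate_subproof O OO x).

Definition coords (x : sphere R n) : n.+1.-tuple (measurableTypeR R) :=
  [tuple sphere_val x i 0 | i < n.+1].

(* The Borel sigma-algebra of the sphere: the trace of the Borel sets of
   R^(n+1), i.e. of the product sigma-algebra of [n.+1.-tuple (measurableTypeR R)]. *)
Definition sphere_measurable : set (set (sphere R n)) :=
  preimage_set_system setT coords measurable.

Let sphere_sigma_algebra : sigma_algebra setT sphere_measurable.
Proof.
apply: sigma_algebra_preimage; exact: sigma_algebra_measurable.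
Qed.

Let sphere_measurable0 : sphere_measurable set0.
Proof. by have [] := sphere_sigma_algebra. Qed.

Let sphere_measurableC A : sphere_measurable A -> sphere_measurable (~` A).
Proof. by rewrite -setTD; have [_ + _] := sphere_sigma_algebra; exact. Qed.

Let sphere_measurable_bigcup (F : (set (sphere R n))^nat) :
  (forall i, sphere_measurable (F i)) -> sphere_measurable (\bigcup_i F i).
Proof. by move=> mF; have [_ _] := sphere_sigma_algebra; exact. Qed.

HB.instance Definition _ := @isMeasurable.Build default_measure_display
  (sphere R n) sphere_measurable sphere_measurable0 sphere_measurableC
  sphere_measurable_bigcup.

End sphere_structure.

Section lebesgue_tuple.
Context {R : realType}.
Local Open Scope ereal_scope.

Definition tuple_cons n (p : measurableTypeR R * n.-tuple (measurableTypeR R)) : n.+1.-tuple (measurableTypeR R) :=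
  [tuple of p.1 :: p.2].

Lemma measurable_tuple_cons n : measurable_fun setT (@tuple_cons n).
Proof. exact: measurable_cons. Qed.

Section step.
Context n (m : {sigma_finite_measure set (n.-tuple (measurableTypeR R)) -> \bar R}).

Definition lebesgue_cons : set (n.+1.-tuple (measurableTypeR R)) -> \bar R :=
  pushforward (lebesgue_measure \x m) (@tuple_cons n).

Let lebesgue_cons0 : lebesgue_cons set0 = 0.
Proof. by rewrite /lebesgue_cons /pushforward preimage_set0 measure0. Qed.

Let lebesgue_cons_ge0 A : 0 <= lebesgue_cons A.
Proof. by rewrite /lebesgue_cons /pushforward; exact: measure_ge0. Qed.

Let lebesgue_cons_sigma_additive : semi_sigma_additive lebesgue_cons.
Proof.
by apply: measure_semi_sigma_additive; exact: measurable_tuple_cons.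
Qed.

HB.instance Definition _ := isMeasure.Build _ _ _ lebesgue_cons
  lebesgue_cons0 lebesgue_cons_ge0 lebesgue_cons_sigma_additive.

Let lebesgue_cons_sigma_finite : sigma_finite setT lebesgue_cons.
Proof.
have /sigma_finiteP[F [TF ndF Foo]] := sigma_finiteT (@lebesgue_measure R).
have /sigma_finiteP[G [TG ndG Goo]] := sigma_finiteT m.
pose u (t : n.+1.-tuple (measurableTypeR R))
  : measurableTypeR R * n.-tuple (measurableTypeR R) :=
  (thead t, [tuple of behead t]).
have Ku : cancel (@tuple_cons n) u.
  by move=> [x t]; rewrite /u theadE; congr pair; exact/val_inj.
have mu : measurable_fun setT u.
  by apply/measurable_fun_pair; [exact: measurable_tnth|exact: measurable_behead].
exists (fun k => u @^-1` (F k `*` G k)) => [|k].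
  apply/esym/seteqP; split=> // t _.
  have [i _ Fi] : (\bigcup_i F i) (u t).1 by rewrite -TF.
  have [j _ Gj] : (\bigcup_j G j) (u t).2 by rewrite -TG.
  exists (maxn i j) => //; split.
    by move: Fi; exact/subsetPset/ndF/leq_maxl.
  by move: Gj; exact/subsetPset/ndG/leq_maxr.
have [mFk Fkoo] := Foo k; have [mGk Gkoo] := Goo k.
have mFG : measurable (F k `*` G k) by exact: measurableX.
split; first by rewrite -[X in measurable X]setTI; exact: mu.
rewrite /lebesgue_cons /pushforward (_ : _ @^-1` _ = F k `*` G k).
  by rewrite product_measure1E// lte_mul_pinfty// ge0_fin_numE.
by apply/funext => p; rewrite /preimage /mkset Ku.
Qed.

HB.instance Definition _ := Measure_isSigmaFinite.Build _ _ _ lebesgue_cons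
  lebesgue_cons_sigma_finite.

End step.

(* Lebesgue measure on R^n, as an iterated product of the one on R. *)
Fixpoint lebesgue_tuple n : {sigma_finite_measure set (n.-tuple (measurableTypeR R)) -> \bar R} :=
  match n with
  | 0 => \d_[tuple]
  | k.+1 => lebesgue_cons (lebesgue_tuple k)
  end.

Lemma measurable_box n (a b : R) : measurable
  [set t : n.-tuple (measurableTypeR R) | forall i, tnth t i \in `]a, b]].
Proof.
rewrite (_ : [set t | _] = \bigcap_(i in [set: 'I_n])
    (fun t : n.-tuple (measurableTypeR R) => tnth t i) @^-1` `]a, b]%classic).
  apply: fin_bigcap_measurable => // i _; rewrite -[X in measurable X]setTI.
  by apply: measurable_tnth => //; exact: measurable_itv.
apply/seteqP; split=> [t tab i _|t tab i]; first exact: tab.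
exact: (tab i Logic.I).
Qed.

Lemma lebesgue_tuple_box n (a b : R) : (a < b)%R -> lebesgue_tuple n
  [set t : n.-tuple (measurableTypeR R) | forall i, tnth t i \in `]a, b]] =
  ((b - a) ^+ n)%:E.
Proof.
move=> ab; elim: n => [|n IH].
  by rewrite /= diracE mem_set// => -[].
rewrite /= /lebesgue_cons /pushforward.
set B := [set t | _] in IH.
rewrite (_ : _ @^-1` _ = `]a, b]%classic `*` B).
  rewrite product_measure1E//=; last exact: measurable_box.
  rewrite [X in _ * X]IH lebesgue_measure_itv/= lte_fin ab exprS.
  by rewrite -EFinD -EFinM.
apply/seteqP; split=> -[x t] /=.
  move=> xt; split=> [|i]; first exact: (xt ord0).
  by have := xt (lift ord0 i); rewrite tnthS.
by move=> [xab tab] i; case: (unliftP ord0 i) => [j|] ->; rewrite ?tnthS.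
Qed.

End lebesgue_tuple.

Section surface_measure.
Context {R : realType} {n : nat}.
Local Notation RT := (measurableTypeR R).
Implicit Types (A : set (sphere R n)) (t : n.+1.-tuple RT).

Definition vec t : 'cV[R]_n.+1 := \col_i tnth t i.

Definition cone A : set (n.+1.-tuple RT) :=
  [set t | exists2 x, A x & exists2 r : R, 0 < r <= 1 &
    vec t = r *: sphere_val x].

(* Surface area measure on S^n, from Lebesgue measure in polar coordinates:
   the cone {r x | x in A, 0 < r <= 1} has volume area(A) / (n + 1). *)
Definition surface_measure A : \bar R :=
  (n.+1%:R%:E * lebesgue_tuple n.+1 (cone A))%E.

Definition unit_vec t : n.+1.-tuple RT :=
  [tuple (Num.sqrt (dot (vec t) (vec t)))^-1 * tnth t i | i < n.+1].

Lemma coneE A (B : set (n.+1.-tuple RT)) : coords @^-1` B = A ->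
  cone A = [set t | 0 < dot (vec t) (vec t) <= 1] `&` unit_vec @^-1` B.
Proof.
move=> <-; apply/seteqP; split=> t /=.
  move=> [x Bx [r /andP[r0 r1] tE]].
  have tt : dot (vec t) (vec t) = r ^+ 2.
    by rewrite tE dotZ (eqP (sphere_valP x)) mulr1 expr2.
  split; first by rewrite tt exprn_gt0//= exprn_ile1// ltW.
  rewrite (_ : unit_vec t = coords x)//; apply: eq_from_tnth => i.
  rewrite !tnth_mktuple tt sqrtr_sqr gtr0_norm//.
  have -> : tnth t i = vec t i 0 by rewrite mxE.
  by rewrite tE mxE mulrA mulVf ?mul1r// gt_eqF.
move=> [/andP[N0 N1] Bt].
set r := Num.sqrt (dot (vec t) (vec t)).
have r0 : 0 < r by rewrite sqrtr_gt0.
have xP : dot (r^-1 *: vec t) (r^-1 *: vec t) == 1.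
  by rewrite dotZ -invfM -expr2 sqr_sqrtr ?ltW// mulVf// gt_eqF.
exists (Sphere xP).
  rewrite /preimage /mkset (_ : coords _ = unit_vec t)//; apply: eq_from_tnth => i.
  by rewrite !tnth_mktuple !mxE.
exists r; first by rewrite r0 -sqrtr1 ler_wsqrtr.
by rewrite scalerA mulfV ?scale1r// gt_eqF.
Qed.

Lemma measurable_dot_vec :
  measurable_fun setT (fun t => dot (vec t) (vec t) : RT).
Proof.
under eq_fun do rewrite dotE; apply: measurable_sum => i.
under eq_fun do rewrite !mxE.
by apply: measurable_funM; exact: measurable_tnth.
Qed.

Lemma measurable_cone A : measurable A -> measurable (cone A).
Proof.
move=> [B mB]; rewrite setTI => /coneE ->; apply: measurableI.
  rewrite (_ : [set _ | _] =
      (fun t => dot (vec t) (vec t) : RT) @^-1` `]0, 1]%classic).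
    rewrite -[X in measurable X]setTI.
    by apply: measurable_dot_vec => //; exact: measurable_itv.
  by apply/seteqP; split=> t /=; rewrite in_itv.
rewrite -[X in measurable X]setTI.
suff: measurable_fun setT unit_vec by exact.
apply/measurable_fun_tnthP => i.
rewrite (_ : _ \o _ = fun t : n.+1.-tuple RT =>
  (Num.sqrt (dot (vec t) (vec t))) `^ (-1) * tnth t i : RT); last first.
  by apply/funext => t /=; rewrite tnth_mktuple powR_inv1// sqrtr_ge0.
apply: measurable_funM; last exact: measurable_tnth.
apply: (measurableT_comp (f := fun r : RT => r `^ (-1) : RT)).
  exact: measurable_powR.
apply: (measurableT_comp (f := fun r : RT => Num.sqrt r : RT)).
  by apply: continuous_measurable_fun; exact: sqrt_continuous.
exact: measurable_dot_vec.
Qed.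

Lemma cone_bigcup (F : (set (sphere R n))^nat) :
  cone (\bigcup_i F i) = \bigcup_i cone (F i).
Proof.
apply/seteqP; split=> [t [x [i _ Fix] xt]|t [i _ [x Fix xt]]].
  by exists i => //; exists x.
by exists x => //; exists i.
Qed.

Lemma cone_inj (x y : sphere R n) (r s : R) : 0 < r -> 0 < s ->
  r *: sphere_val x = s *: sphere_val y -> x = y.
Proof.
move=> r0 s0 xy; apply/val_inj => /=.
suff rs : r = s.
  by move/(congr1 ( *:%R r^-1)): xy; rewrite -rs !scalerA mulVf ?gt_eqF// !scale1r.
have : dot (r *: sphere_val x) (r *: sphere_val x) =
       dot (s *: sphere_val y) (s *: sphere_val y) by rewrite xy.
rewrite !dotZ (eqP (sphere_valP x)) (eqP (sphere_valP y)) !mulr1 -!expr2.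
by move/eqP; rewrite eqrXn2 ?ltW// => /eqP.
Qed.

Lemma trivIset_cone (F : (set (sphere R n))^nat) :
  trivIset setT F -> trivIset setT (cone \o F).
Proof.
move=> tF i j _ _ [t /= [[x Fx [r /andP[r0 _] tx]] [y Fy [s /andP[s0 _] ty]]]].
apply: tF => //; exists x; split=> //.
by rewrite (@cone_inj x y r s)// -tx -ty.
Qed.

Local Open Scope ereal_scope.

Let surface_measure0 : surface_measure set0 = 0.
Proof.
rewrite /surface_measure (_ : cone set0 = set0) ?measure0 ?mule0//.
by apply/seteqP; split=> // t [].
Qed.

Let surface_measure_ge0 A : 0 <= surface_measure A.
Proof. by rewrite /surface_measure mule_ge0// measure_ge0. Qed.

Let surface_measure_sigma_additive : semi_sigma_additive surface_measure.
Proof.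
move=> F mF tF mUF; rewrite /surface_measure cone_bigcup.
rewrite (_ : (fun k => _) = (fun k =>
    n.+1%:R%:E * \sum_(0 <= i < k) lebesgue_tuple n.+1 (cone (F i)))).
  apply: cvgeZl => //; apply: measure_sigma_additive.
    by move=> i; exact: measurable_cone.
  exact: trivIset_cone.
by apply/funext => k; rewrite ge0_sume_distrr// => i _; exact: measure_ge0.
Qed.

HB.instance Definition _ := isMeasure.Build _ _ _ surface_measure
  surface_measure0 surface_measure_ge0 surface_measure_sigma_additive.

Lemma surface_measureT_gt0 : 0 < surface_measure setT.
Proof.
rewrite /surface_measure mule_gt0//.
pose a : R := (n.+1%:R^-1)%R.
have a0 : (0 < a)%R by rewrite invr_gt0.
have := lebesgue_tuple_box n.+1 a0; set B := [set t | _] => BE.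
apply: (@lt_le_trans _ _ (lebesgue_tuple n.+1 B)).
  by rewrite BE lte_fin subr0 exprn_gt0.
apply: le_measure; rewrite ?inE.
- exact: measurable_box.
- apply: measurable_cone; exact: measurableT.
rewrite (@coneE setT setT) ?preimage_setT// setIT => t Bt /=.
have tB i : (0 < tnth t i <= a)%R by have := Bt i; rewrite in_itv.
rewrite dotE; apply/andP; split.
  rewrite (bigD1 ord0)//= ltr_pwDl//.
    by rewrite mxE mulr_gt0//; have /andP[] := tB ord0.
  by rewrite sumr_ge0// => i _; rewrite -expr2 sqr_ge0.
apply: (@le_trans _ _ (\sum_(i < n.+1) a)%R).
  apply: ler_sum => i _; rewrite mxE; have /andP[ti0 tia] := tB i.
  rewrite (le_trans (ler_wpM2l (ltW ti0) tia))// ler_piMl ?(ltW a0)//.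
  by rewrite (le_trans tia)// invf_le1// ler1n.
by rewrite sumr_const card_ord -mulr_natl mulfV.
Qed.

Lemma surface_measureT_fin : surface_measure setT < +oo.
Proof.
rewrite /surface_measure lte_mul_pinfty//.
have := @lebesgue_tuple_box R n.+1 (-2) 2; set B := [set t | _] => BE.
apply: (@le_lt_trans _ _ (lebesgue_tuple n.+1 B)); last first.
  by rewrite BE ?ltry//; lra.
apply: le_measure; rewrite ?inE.
- apply: measurable_cone; exact: measurableT.
- exact: measurable_box.
rewrite (@coneE setT setT) ?preimage_setT// setIT => t /= /andP[_].
rewrite dotE => tt i; rewrite /= in_itv/=.
have : (tnth t i ^+ 2 <= 1)%R.
  apply: le_trans tt; rewrite (bigD1 i)//= mxE -expr2 lerDl.
  by rewrite sumr_ge0// => j _; rewrite -expr2 sqr_ge0.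
by move=> ti; apply/andP; split; nra.
Qed.

End surface_measure.

Section directional_depth.
Context {R : realType} {n : nat}.
Implicit Types (d : sphere R n -> sphere R n -> R) (delta : R -> R).

Record is_distance d : Prop := IsDistance {
  distance_eq0 : forall x y, d x y = 0 <-> x = y ;
  distance_sym : forall x y, d x y = d y x ;
  distance_triangle : forall x y z, d x z <= d x y + d y z }.

Definition rotation_invariant d :=
  forall (O : 'M[R]_n.+1) (OO : O^T *m O = 1%:M) x y,
    d (rotate OO x) (rotate OO y) = d x y.

(* Only the values of [delta] on [-1, 1] matter. *)
Definition dist_of delta : sphere R n -> sphere R n -> R :=
  fun x y => delta (dot x y).

Definition dist_sup d : R := sup [set d p.1 p.2 | p in setT].

Definition depth d (theta : sphere R n) (H : probability (sphere R n) R) : R :=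
  dist_sup d - fine 'E_H[d theta].

Definition has_density (H : probability (sphere R n) R) (f : sphere R n -> R) :=
  forall A, measurable A -> H A = (\int[surface_measure]_(x in A) (f x)%:E)%E.

End directional_depth.

(* Main.v *)
Require Import Defs.
From HB Require Import structures.
From mathcomp Require Import all_boot all_order all_algebra.
From mathcomp Require Import all_classical all_reals all_analysis.
From mathcomp Require Import measurable_realfun lra ring.
Import Order.TTheory GRing.Theory Num.Theory.
Import numFieldNormedType.Exports.
Local Open Scope classical_set_scope.
Local Open Scope ring_scope.

Set Implicit Arguments.
Unset Strict Implicit.
Unset Printing Implicit Defensive.

(** Write [u] for the scalar product of a point of the sphere with [theta0].
The depth is a constant minus an expected distance, so the first claim says
that [theta0] minimizes the expected distance, and the second that this minimum
strictly decreases with the concentration.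

The first claim is a rearrangement inequality ([moment_min]).  The reflection
exchanging [theta] and [theta0] preserves the surface measure, so averaging
with the reflected copy reduces the comparison to the pointwise inequality
[(delta s - delta t) * (f s - f t) <= 0], where [delta] decreases and the
density profile [f] increases.

The second claim is a comparison of two densities with a monotone likelihood
ratio.  The derivative of [ln (h (k2 * u)) - ln (h (k1 * u))] times [u] is the
increment of [t * (ln h)' t] from [k1 * u] to [k2 * u], which has the sign of
[u]; so the ratio of the two densities is strictly increasing in [u]
([ratio_incr]) and they cross at one latitude [u0] ([density_crossing]): the
more concentrated one is smaller below [u0] and larger above.  As both have
mass one, the difference of the expectations of [delta u] is the integral of
[(f2 u - f1 u) * (delta u - delta u0)], which is negative off the latitude
[u = u0] ([moment_lt]); and no scalar product with a fixed point is almost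
everywhere constant ([dot_nonconstant]), so the inequality is strict.

Both claims rest on the orthogonal invariance of the surface measure, hence of
Lebesgue measure on [R^(n+1)] ([lebesgue_tuple_mx]).  The latter is the usual
uniqueness argument for Haar measure: the image of Lebesgue measure under an
orthogonal matrix is again translation invariant, so Tonelli's theorem makes it
proportional to Lebesgue measure, and the unit ball fixes the factor. *)

(** * Translation invariance of Lebesgue measure *)

Section translation.
Context {R : realType}.
Local Notation RT := (measurableTypeR R).

Definition translate n (v t : n.-tuple RT) : n.-tuple RT :=
  [tuple tnth t i + tnth v i : R | i < n].

Lemma measurable_addr (a : R) :
  measurable_fun setT (fun x : RT => (x + a : R) : RT).
Proof. by apply: measurable_funD => //; exact: measurable_cst. Qed.

Lemma measurable_translate n (v : n.-tuple RT) :
  measurable_fun setT (translate v).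
Proof.
apply/measurable_fun_tnthP => i.
rewrite (_ : _ \o _ = fun t : n.-tuple RT => (tnth t i + tnth v i : R) : RT).
  exact: measurableT_comp (measurable_addr _) (measurable_tnth i).
by apply/funext => t /=; rewrite tnth_mktuple.
Qed.

Lemma lebesgue_measure_addr (a : R) (A : set RT) : measurable A ->
  lebesgue_measure ((fun x : RT => (x + a : R)) @^-1` A) =
  lebesgue_measure A :> \bar R.
Proof.
move=> mA; rewrite -[LHS]/(pushforward lebesgue_measure
  (fun x : RT => (x + a : R) : RT) A).
apply/esym/lebesgue_measure_unique => //=; first exact: measurable_addr.
move=> ma _ [[b c]] _ <-.
rewrite /pushforward (_ : _ @^-1` _ = `]b - a, c - a]%classic).
  rewrite !lebesgue_measure_itv/= !lte_fin ltrD2r -!EFinB.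
  by case: ifP => // _; congr EFin; ring.
by apply/seteqP; split=> x /=; rewrite !in_itv/= ltrBlDr lerBrDr.
Qed.

(** A translation acts coordinatewise, so its image of a product measure agrees
with that measure on rectangles as soon as each factor is invariant. *)
Lemma lebesgue_tuple_translate n (v : n.-tuple RT) A : measurable A ->
  lebesgue_tuple n (translate v @^-1` A) = lebesgue_tuple n A.
Proof.
elim: n v A => [v A _|n IH v A mA].
  congr (lebesgue_tuple 0 _); apply/seteqP.
  by split=> t; rewrite /preimage /mkset (tuple0 t) (tuple0 (translate v _)).
case/tupleP: v => a v.
pose phi (p : RT * n.-tuple RT) : RT * n.-tuple RT :=
  ((p.1 + a : R), translate v p.2).
have mphi : measurable_fun setT phi.
  apply/measurable_fun_pair => /=.
    exact: measurableT_comp (measurable_addr a) measurable_fst.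
  exact: measurableT_comp (measurable_translate v) measurable_snd.
rewrite /= /lebesgue_cons /pushforward.
rewrite (_ : _ @^-1` _ = phi @^-1` (@tuple_cons R n @^-1` A)); last first.
  apply/seteqP; split=> -[x t] /=; rewrite /preimage /mkset;
  by rewrite (_ : translate _ _ = tuple_cons (x + a, translate v t))//;
    apply: eq_from_tnth => i; rewrite tnth_mktuple;
    case: (unliftP ord0 i) => [j|] ->; rewrite ?tnthS ?tnth0 ?tnth_mktuple.
have mB : measurable (@tuple_cons R n @^-1` A).
  by rewrite -[X in measurable X]setTI; exact: measurable_tuple_cons.
rewrite -[LHS]/(pushforward (lebesgue_measure \x lebesgue_tuple n)%E phi _).
apply/esym/product_measure_unique => // B C mB' mC.
rewrite /= /pushforward (_ : _ @^-1` _ =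
    ((fun x : RT => (x + a : R)) @^-1` B) `*` (translate v @^-1` C))//.
rewrite product_measure1E//.
- by congr (_ * _)%E; [exact: lebesgue_measure_addr|exact: IH].
- by rewrite -[X in measurable X]setTI; exact: measurable_addr.
- by rewrite -[X in measurable X]setTI; exact: measurable_translate.
Qed.

End translation.

(** * Orthogonal invariance of Lebesgue measure *)

Section orthogonal.
Context {R : realType} {n : nat}.
Local Notation RT := (measurableTypeR R).
Local Notation T := (n.+1.-tuple RT).
Implicit Types (O : 'M[R]_n.+1) (s t : T) (A B : set T).

Definition unvec (v : 'cV[R]_n.+1) : T := [tuple v i 0 | i < n.+1].

Lemma unvecK v : vec (unvec v) = v.
Proof. by apply/matrixP => i j; rewrite mxE tnth_mktuple ord1. Qed.

Lemma vecK t : unvec (vec t) = t.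
Proof. by apply: eq_from_tnth => i; rewrite tnth_mktuple mxE. Qed.

Lemma vec_translate s t : vec (translate s t) = vec t + vec s.
Proof. by apply/matrixP => i j; rewrite !mxE tnth_mktuple. Qed.

Definition mxtuple O t : T := unvec (O *m vec t).

Lemma measurable_mxtuple O : measurable_fun setT (mxtuple O).
Proof.
apply/measurable_fun_tnthP => i.
rewrite (_ : _ \o _ = fun t : T => (\sum_j O i j * tnth t j : R) : RT).
  apply: measurable_sum => j; apply: measurable_funM.
    exact: measurable_cst.
  exact: measurable_tnth.
apply/funext => t /=; rewrite tnth_mktuple mxE.
by apply: eq_bigr => j _; rewrite mxE.
Qed.

Lemma dot_mulmx O (x y : 'cV[R]_n.+1) : O^T *m O = 1%:M ->
  dot (O *m x) (O *m y) = dot x y.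
Proof. by move=> OO; rewrite /dot trmx_mul mulmxA -(mulmxA _ O^T) OO mulmx1. Qed.

(** The reference set of the uniqueness argument: it is symmetric and orthogonally
invariant, and the bounds on the total surface area bound its volume. *)
Definition punctured_ball : set T := cone (@setT (sphere R n)).

Lemma punctured_ballE : punctured_ball = [set t | 0 < dot (vec t) (vec t) <= 1].
Proof. by rewrite /punctured_ball (@coneE _ _ _ setT) ?preimage_setT// setIT. Qed.

Lemma measurable_punctured_ball : measurable punctured_ball.
Proof. by apply: measurable_cone; exact: measurableT. Qed.

Lemma lebesgue_punctured_ball_gt0 : (0 < lebesgue_tuple n.+1 punctured_ball)%E.
Proof.
have := @surface_measureT_gt0 R n; rewrite /surface_measure lt0e => /andP[+ _].
by rewrite mule_eq0 negb_or => /andP[_ ?]; rewrite lt0e measure_ge0 andbT.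
Qed.

Lemma lebesgue_punctured_ball_fin : lebesgue_tuple n.+1 punctured_ball \is a fin_num.
Proof.
rewrite ge0_fin_numE ?measure_ge0//.
have := @surface_measureT_fin R n; rewrite /surface_measure -/punctured_ball.
case: (lebesgue_tuple n.+1 punctured_ball) => [r _||]; first exact: ltry.
  by rewrite mulry gtr0_sg// mul1e ltxx.
by [].
Qed.

Lemma measurable_translate_mx O :
  measurable_fun setT (fun p : T * T => translate (mxtuple O p.1) p.2).
Proof.
apply/measurable_fun_tnthP => i.
rewrite (_ : _ \o _ = fun p : T * T =>
    (tnth p.2 i + tnth (mxtuple O p.1) i : R) : RT).
  apply: measurable_funD.
    exact: measurableT_comp (measurable_tnth i) measurable_snd.
  apply: (measurableT_comp (measurable_tnth i)).
  exact: measurableT_comp (measurable_mxtuple O) measurable_fst.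
by apply/funext => p /=; rewrite tnth_mktuple.
Qed.

(** Let [A] be the punctured ball.  The measure of the pairs [(x, y)] with
[O x] in [A] and [y + O x] in [B] is [L A * L B], by translation in [y].
Translating [x] by [O^T y] instead turns the two conditions into
[y - O x] in [A] and [O x] in [B], by symmetry of [A], which gives
[L A * L (O^-1 B)].  Then [L A] is cancelled. *)
Lemma lebesgue_tuple_mx O B : O^T *m O = 1%:M -> measurable B ->
  lebesgue_tuple n.+1 (mxtuple O @^-1` B) = lebesgue_tuple n.+1 B.
Proof.
move=> OO mB; pose L : {sigma_finite_measure set T -> \bar R} := lebesgue_tuple n.+1.
have OO' : O *m O^T = 1%:M by exact: mulmx1C.
have mA := measurable_punctured_ball.
have mOB : measurable (mxtuple O @^-1` B).
  by rewrite -[X in measurable X]setTI; exact: measurable_mxtuple.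
pose D : set (T * T) :=
  [set p | punctured_ball (mxtuple O p.1) /\ B (translate (mxtuple O p.1) p.2)].
pose D' : set (T * T) :=
  [set p | B (mxtuple O p.1) /\ punctured_ball (translate (mxtuple (- O) p.1) p.2)].
have mD : measurable D.
  apply: measurableI; rewrite -[X in measurable X]setTI.
    exact: (measurableT_comp (measurable_mxtuple O) measurable_fst).
  exact: (@measurable_translate_mx O).
have mD' : measurable D'.
  apply: measurableI; rewrite -[X in measurable X]setTI.
    exact: (measurableT_comp (measurable_mxtuple O) measurable_fst).
  exact: (@measurable_translate_mx (- O)).
(* Cavalieri's principle for sections that are empty or translates of one set. *)
have section_integral (A C : set T) (F : set (T * T)) : measurable A ->
    measurable C ->
    (forall x, A x -> exists v, xsection F x = translate v @^-1` C) ->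
    (forall x, ~ A x -> xsection F x = set0) -> ((L \x L) F = L C * L A)%E.
  move=> mA' mC FA FnA; rewrite /product_measure1 -[in RHS](setIT A).
  rewrite -integral_indic// -ge0_integralZl//; last first.
    exact/measurable_EFinP.
  apply: eq_integral => x _ /=; rewrite indicE.
  have [xA|/negP xA] := boolP (x \in A).
    have [v ->] := FA x (set_mem xA).
    by rewrite mule1; exact: lebesgue_tuple_translate.
  by rewrite mule0 FnA ?measure0// => /mem_set.
have EA x : punctured_ball (mxtuple O x) = punctured_ball x.
  by rewrite punctured_ballE /= unvecK dot_mulmx.
have swap F : measurable F -> ((L \x L) F = (L \x^ L) F)%E.
  by move=> mF; apply: product_measure_unique => // *; exact: product_measure2E.
have E1 : ((L \x L) D = L B * L punctured_ball)%E.
  apply: section_integral => // x.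
    move=> Ax; exists (mxtuple O x); apply/seteqP; split=> y.
      by move/set_mem => [].
    by move=> By; apply/mem_set; split; rewrite /= ?EA.
  by move=> Ax; apply/seteqP; split=> // y /set_mem[/=]; rewrite EA.
have E2 : ((L \x L) D' = L punctured_ball * L (mxtuple O @^-1` B))%E.
  apply: section_integral => // x.
    move=> Bx; exists (mxtuple (- O) x); apply/seteqP; split=> y.
      by move/set_mem => [].
    by move=> By; apply/mem_set.
  by move=> Bx; apply/seteqP; split=> // y /set_mem[].
have E3 : ((L \x^ L) D = (L \x^ L) D')%E.
  rewrite /product_measure2; apply: eq_integral => y _ /=.
  have <- : translate (mxtuple O^T y) @^-1` (ysection D' y) = ysection D y.
    have E x : mxtuple O (translate (mxtuple O^T y) x) =
               translate (mxtuple O x) y.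
      rewrite /mxtuple vec_translate unvecK mulmxDr mulmxA OO' mul1mx.
      by rewrite -[RHS]vecK vec_translate unvecK addrC.
    have E' x : dot (vec (translate (mxtuple (- O)
          (translate (mxtuple O^T y) x)) y))
        (vec (translate (mxtuple (- O) (translate (mxtuple O^T y) x)) y)) =
        dot (vec (mxtuple O x)) (vec (mxtuple O x)).
      rewrite vec_translate /mxtuple !unvecK vec_translate unvecK mulNmx.
      rewrite mulmxDr mulmxA OO' mul1mx opprD addrCA subrr addr0.
      by rewrite -scaleN1r dotZ mulrNN !mul1r.
    apply/seteqP; split=> x /set_mem[]; rewrite /= ?E ?E' => P Q;
      apply/mem_set; split; rewrite /= ?E//; move: P Q;
      by rewrite !punctured_ballE /= E'.
  apply: lebesgue_tuple_translate; exact: measurable_ysection.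
have E4 : (L B * L punctured_ball = L punctured_ball * L (mxtuple O @^-1` B))%E.
  exact: etrans (esym E1) (etrans (swap D mD)
    (etrans E3 (etrans (esym (swap D' mD')) E2))).
apply: (inc_inj (lee_pmul2l lebesgue_punctured_ball_fin lebesgue_punctured_ball_gt0)).
exact: esym (etrans (muleC _ _) E4).
Qed.

End orthogonal.

(** * Orthogonal invariance of the surface measure *)

Section surface.
Context {R : realType} {n : nat}.
Local Notation S := (sphere R n).
Local Notation mu := (@surface_measure R n).

HB.instance Definition _ := Measure_isFinite.Build _ _ _ mu
  (lty_fin_num_fun (@surface_measureT_fin R n)).

Lemma measurable_coords : measurable_fun setT (@coords R n).
Proof. by move=> _ B mB; rewrite setTI; exists B => //; rewrite setTI. Qed.

Lemma measurable_dot (y : S) : measurable_fun setT (fun x : S => dot x y : R).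
Proof.
under eq_fun do rewrite dotE; apply: measurable_sum => i.
apply: measurable_funM; last exact: measurable_cst.
rewrite (_ : (fun x : S => _) = (fun t => tnth t i) \o @coords R n).
  exact: measurableT_comp (measurable_tnth i) measurable_coords.
by apply/funext => x /=; rewrite tnth_mktuple.
Qed.

Lemma dotC (x y : 'cV[R]_n.+1) : dot x y = dot y x.
Proof. by rewrite !dotE; apply: eq_bigr => i _; rewrite mulrC. Qed.

Lemma dotDl (x y z : 'cV[R]_n.+1) : dot (x + y) z = dot x z + dot y z.
Proof. by rewrite /dot linearD /= mulmxDl mxE. Qed.

Lemma dotNl (x y : 'cV[R]_n.+1) : dot (- x) y = - dot x y.
Proof. by rewrite -scaleN1r -{1}(scale1r y) dotZ mulr1 mulN1r. Qed.

Lemma dot_ge0 (x : 'cV[R]_n.+1) : 0 <= dot x x.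
Proof. by rewrite dotE sumr_ge0// => i _; rewrite -expr2 sqr_ge0. Qed.

Lemma dot_sphere (x : S) : dot x x = 1.
Proof. exact/eqP/sphere_valP. Qed.

Lemma dot_itv (x y : S) : -1 <= dot x y <= 1.
Proof.
move: (dot_sphere x) (dot_sphere y).
set u : 'cV_n.+1 := x; set v : 'cV_n.+1 := y => uu vv.
have := dot_ge0 (u + v); have := dot_ge0 (u - v).
rewrite !(dotDl, dotNl) ![dot _ (_ + _)]dotC !(dotDl, dotNl) uu vv.
by rewrite [dot v u]dotC => *; apply/andP; split; lra.
Qed.

Lemma measurable_rotate (O : 'M[R]_n.+1) (OO : O^T *m O = 1%:M) :
  measurable_fun setT (rotate OO : S -> S).
Proof.
move=> _ A [B mB <-]; rewrite !setTI; exists (mxtuple O @^-1` B).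
  by rewrite -[X in measurable X]setTI; exact: measurable_mxtuple.
rewrite setTI; apply/seteqP; split=> x; rewrite /preimage /mkset;
  suff -> : mxtuple O (coords x) = coords (rotate OO x) by [];
  by apply: eq_from_tnth => i; rewrite !tnth_mktuple/=; congr ((_ *m _) _ _);
    apply/matrixP => j k; rewrite mxE tnth_mktuple ord1.
Qed.

Lemma cone_rotate (O : 'M[R]_n.+1) (OO : O^T *m O = 1%:M) (A : set S) :
  cone (rotate OO @^-1` A) = mxtuple O @^-1` cone A.
Proof.
have OO' : O^T^T *m O^T = 1%:M by rewrite trmxK; exact: mulmx1C.
apply/seteqP; split=> t /=.
  move=> [x Ax [r r01 tE]]; exists (rotate OO x) => //; exists r => //.
  by rewrite unvecK tE -scalemxAr.
move=> [x Ax [r r01]]; rewrite unvecK => tE.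
exists (rotate OO' x).
  rewrite /preimage /mkset (_ : rotate _ _ = x)//; apply/val_inj => /=.
  by rewrite mulmxA (mulmx1C OO) mul1mx.
by exists r => //=; rewrite scalemxAr -tE mulmxA OO mul1mx.
Qed.

Lemma surface_measure_rotate (O : 'M[R]_n.+1) (OO : O^T *m O = 1%:M)
  (A : set S) : measurable A -> mu (rotate OO @^-1` A) = mu A.
Proof.
move=> mA; rewrite /surface_measure cone_rotate lebesgue_tuple_mx//.
exact: measurable_cone.
Qed.

Lemma Rintegral_rotate (O : 'M[R]_n.+1) (OO : O^T *m O = 1%:M) (f : S -> R) :
  measurable_fun setT f -> (forall x, 0 <= f x) ->
  \int[mu]_x f (rotate OO x) = \int[mu]_x f x.
Proof.
move=> mf f0; congr fine.
have mr := measurable_rotate OO.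
transitivity (\int[pushforward mu (rotate OO)]_x (f x)%:E)%E.
  rewrite ge0_integral_pushforward//; first exact/measurable_EFinP.
  by move=> x _; rewrite lee_fin.
by apply: eq_measure_integral => A mA _; exact: surface_measure_rotate.
Qed.

(** * Reflections exchanging two points *)

(** The reflection in the hyperplane orthogonal to [x - y].  When [x = y] the
division by zero yields the identity, so no case distinction is needed. *)
Definition householder (x y : 'cV[R]_n.+1) : 'M[R]_n.+1 :=
  1%:M - (2 / dot (x - y) (x - y)) *: ((x - y) *m (x - y)^T).

Lemma dot_eq0 (x : 'cV[R]_n.+1) : dot x x = 0 -> x = 0.
Proof.
rewrite dotE => /eqP; rewrite psumr_eq0 => [/allP x0|i _]; last first.
  by rewrite -expr2 sqr_ge0.
apply/matrixP => i j; rewrite ord1 mxE; apply/eqP.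
by have := x0 i (mem_index_enum i); rewrite mulf_eq0 orbb.
Qed.

Lemma householderE (x y z : 'cV[R]_n.+1) : householder x y *m z =
  z - (2 / dot (x - y) (x - y) * dot (x - y) z) *: (x - y).
Proof.
rewrite /householder mulmxBl mul1mx -scalemxAl -mulmxA -scalerA.
by rewrite [(x - y)^T *m z]mx11_scalar -/(dot (x - y) z) mul_mx_scalar.
Qed.

Lemma householderC (x y : 'cV[R]_n.+1) : householder x y = householder y x.
Proof.
rewrite /householder -(opprB y x) linearN /= mulNmx mulmxN opprK.
by rewrite dotNl dotC dotNl opprK.
Qed.

Lemma householder_orth (x y : 'cV[R]_n.+1) :
  (householder x y)^T *m householder x y = 1%:M.
Proof.
have tH : (householder x y)^T = householder x y.
  by rewrite /householder linearB linearZ /= trmx1 trmx_mul trmxK.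
rewrite tH {2}/householder mulmxBr mulmx1 -scalemxAr mulmxA householderE.
rewrite {1}/householder; set w := x - y.
have [/dot_eq0 ->|w0] := eqVneq (dot w w) 0.
  by rewrite scaler0 subr0 mul0mx scaler0 !subr0.
(* [householderE] maps w to w - 2 w = - w. *)
rewrite divfK// scaler_nat mulr2n opprD addNKr mulNmx scalerN opprK subrK.
by [].
Qed.

Lemma householder_swap (x y : S) : householder x y *m x = y.
Proof.
move: (dot_sphere x) (dot_sphere y); rewrite householderE.
set u : 'cV_n.+1 := x; set v : 'cV_n.+1 := y => uu vv.
have [E|w0] := eqVneq (dot (u - v) (u - v)) 0.
  by have /subr0_eq -> := dot_eq0 E; rewrite subrr scaler0 subr0.
suff -> : 2 / dot (u - v) (u - v) * dot (u - v) u = 1.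
  by rewrite scale1r opprB addrC subrK.
rewrite mulrAC -[RHS](mulfV w0); congr (_ / _).
rewrite !dotDl !dotNl ![dot _ (_ - _)]dotC !dotDl !dotNl.
by rewrite uu vv [dot v u]dotC; ring.
Qed.

(** With [householderC], the reflection exchanges the scalar products with [x]
and with [y]; this is how all changes of pole are made. *)
Lemma dot_reflect (x y : S) (z : 'cV[R]_n.+1) :
  dot (householder x y *m z) y = dot z x.
Proof.
rewrite -(dot_mulmx z x (householder_orth x y)).
by rewrite householder_swap.
Qed.

End surface.

(** * Monotone likelihood ratio *)

Section likelihood.
Context {R : realType} (h : R -> R).
Hypothesis h_ge0 : forall t, 0 <= h t.
Hypothesis h_incr : {homo h : s t / s < t}.
Hypothesis h_derivable : forall t, derivable h t 1.

Lemma incr_ge0_gt0 t : 0 < h t.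
Proof. by rewrite (le_lt_trans (h_ge0 (t - 1)))// h_incr// gtrBl. Qed.

Hypothesis h_log : {homo (fun t => t * derive1 (fun u => ln (h u)) t) : s t / s < t}.

Let l u := ln (h u).

Lemma derivable_ln_comp t : derivable l t 1.
Proof.
have hd := derivableP (@h_derivable t).
have ld := is_derive1_ln (incr_ge0_gt0 t).
exact: (@ex_derive _ _ _ _ _ _ _ (is_derive1_comp ld hd)).
Qed.

Let log_ratio k1 k2 u := l (k2 * u) - l (k1 * u).

Let is_derive_log_ratio (k1 k2 u : R) :
  is_derive u (1 : R) (log_ratio k1 k2)
    (k2 * derive1 l (k2 * u) - k1 * derive1 l (k1 * u)).
Proof.
have D k : is_derive u (1 : R) (fun u => l (k * u)) (k * derive1 l (k * u)).
  have dl := derivableP (@derivable_ln_comp (k * u)).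
  rewrite derive1E mulrC; apply: (is_derive1_comp dl).
  have := is_deriveZ k (is_derive_id u (1 : R)).
  by rewrite /GRing.scale /= mulr1.
exact: is_deriveB.
Qed.

(** Times [u ^+ 2], the derivative at [u] is [u] times the increment of
[t * (ln h)' t] from [k1 * u] to [k2 * u], both factors having the sign of [u].
Nothing strict is known at [u = 0], so the mean value theorem is applied on
intervals with no zero inside and the two sides are glued. *)
Lemma log_ratio_incr (k1 k2 : R) : 0 < k1 -> k1 < k2 ->
  {homo log_ratio k1 k2 : s t / s < t}.
Proof.
move=> k10 k12.
have k20 : 0 < k2 by exact: lt_trans k12.
have dF (u : R) : u != 0 ->
    0 < k2 * derive1 l (k2 * u) - k1 * derive1 l (k1 * u).
  move=> u0; rewrite -(pmulr_rgt0 _ (_ : 0 < u ^+ 2)) ?exprn_even_gt0//.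
  have -> : u ^+ 2 * (k2 * derive1 l (k2 * u) - k1 * derive1 l (k1 * u)) =
    u * ((k2 * u) * derive1 l (k2 * u) - (k1 * u) * derive1 l (k1 * u)) by ring.
  have [u0'|u0'] := ltP 0 u.
    by rewrite pmulr_rgt0// subr_gt0; apply: h_log; rewrite ltr_pM2r.
  have {u0'} : u < 0 by rewrite lt_neqAle u0.
  by move=> un; rewrite nmulr_rgt0// subr_lt0; apply: h_log; rewrite ltr_nM2r.
have step s t : s < t -> 0 <= s \/ t <= 0 -> log_ratio k1 k2 s < log_ratio k1 k2 t.
  move=> st st0.
  have cF : {within `[s, t], continuous (log_ratio k1 k2)}.
    apply: continuous_subspaceT => x.
    apply/differentiable_continuous/derivable1_diffP.
    exact: (@ex_derive _ _ _ _ _ _ _ (is_derive_log_ratio k1 k2 x)).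
  have [c] := MVT st (fun x _ => is_derive_log_ratio k1 k2 x) cF.
  rewrite in_itv/= => /andP[sc ct] E.
  rewrite -subr_gt0 E mulr_gt0//; last by rewrite subr_gt0.
  apply: dF.
  by case: st0 => ?; [rewrite gt_eqF|rewrite lt_eqF]; lra.
move=> s t st.
have [s0|s0] := leP 0 s; first by apply: step => //; left.
have [t0|t0] := leP t 0; first by apply: step => //; right.
apply: (@lt_trans _ _ (log_ratio k1 k2 0)); apply: step => //; [by right|by left].
Qed.

Lemma ratio_incr (k1 k2 : R) : 0 < k1 -> k1 < k2 ->
  {homo (fun u => h (k2 * u) / h (k1 * u)) : s t / s < t}.
Proof.
move=> k10 k12 s t /(log_ratio_incr k10 k12); rewrite /log_ratio /l.
have h0 := incr_ge0_gt0; rewrite -!ln_div ?posrE//.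
by rewrite ltr_ln// posrE divr_gt0.
Qed.

Lemma derivable_profile_continuous : continuous h.
Proof.
by move=> x; apply/differentiable_continuous/derivable1_diffP.
Qed.

(** When the likelihood ratio stays on one side of [c1 / c2], the crossing point
is an end of [[-1, 1]]; otherwise the intermediate value theorem gives it. *)
Lemma density_crossing (c1 c2 k1 k2 : R) : 0 < c1 -> 0 < c2 -> 0 < k1 -> k1 < k2 ->
  exists2 u0, -1 <= u0 <= 1 & forall u, -1 <= u <= 1 ->
   (u < u0 -> c2 * h (k2 * u) < c1 * h (k1 * u)) /\
   (u0 < u -> c1 * h (k1 * u) < c2 * h (k2 * u)).
Proof.
move=> c10 c20 k10 k12; have h0 := incr_ge0_gt0.
pose r u := h (k2 * u) / h (k1 * u).
have r_incr := ratio_incr k10 k12.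
have ltE u : (c2 * h (k2 * u) < c1 * h (k1 * u)) = (r u < c1 / c2).
  by rewrite /r ltr_pdivrMr// mulrAC ltr_pdivlMr// mulrC.
have gtE u : (c1 * h (k1 * u) < c2 * h (k2 * u)) = (c1 / c2 < r u).
  by rewrite /r ltr_pdivlMr// mulrAC ltr_pdivrMr// [_ * c2]mulrC.
have [r1|r1] := leP (r 1) (c1 / c2).
  exists 1; first by lra.
  move=> u u1; split; last by lra.
  by move=> /r_incr; rewrite ltE -/(r u) => /lt_le_trans; apply.
have [rN1|rN1] := leP (c1 / c2) (r (- 1)).
  exists (- 1); first by lra.
  move=> u u1; split; first by lra.
  by move=> /r_incr; rewrite gtE -/(r u); exact: le_lt_trans.
have cr : {within `[- 1, 1], continuous r}.
  apply: continuous_subspaceT => x; apply: cvgM.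
    apply: continuous_comp; last exact: derivable_profile_continuous.
    exact: mulrl_continuous.
  apply: cvgV; first by rewrite gt_eqF.
  apply: continuous_comp; last exact: derivable_profile_continuous.
  exact: mulrl_continuous.
have le11 : -1 <= 1 :> R by lra.
have [|c cI cE] := IVT (v := c1 / c2) le11 cr.
  by rewrite ge_min le_max (ltW rN1) (ltW r1) orbT.
exists c; first by move: cI; rewrite in_itv.
by move=> u u1; rewrite ltE gtE -cE; split=> /r_incr.
Qed.

End likelihood.

(** * Densities and strict positivity of integrals *)

Section density.
Local Open Scope ereal_scope.
Context d (T : measurableType d) (R : realType).
Variables (mu : {sigma_finite_measure set T -> \bar R}) (P : probability T R).
Variable f : T -> R.
Hypothesis mf : measurable_fun setT f.
Hypothesis Pf : forall A, measurable A -> P A = \int[mu]_(x in A) (f x)%:E.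

(** The given density agrees almost everywhere with the Radon-Nikodym derivative,
for which the change of variables is known. *)
Lemma expectation_density (g : T -> R) : measurable_fun setT g ->
  (forall x, 0 <= g x)%R -> 'E_P[g] = \int[mu]_x (g x * f x)%:E.
Proof.
move=> mg g0.
have Pmu : P `<< mu.
  apply/null_content_dominatesP => A mA A0; rewrite Pf// null_set_integral//.
  exact/measurable_EFinP/measurable_funTS.
have mRN := measurable_int _ (Radon_Nikodym_SigmaFinite.f_integrable Pmu).
rewrite unlock -(Radon_Nikodym_SigmaFinite.change_of_variables Pmu)//; last first.
  exact/measurable_EFinP.
apply: ae_eq_integral => //.
- by apply: emeasurable_funM => //; exact/measurable_EFinP.
- by apply/measurable_EFinP; exact: measurable_funM.
have := @integral_ae_eq _ _ _ mu setT measurableT (EFin \o f) _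
  (Radon_Nikodym_SigmaFinite.f_integrable Pmu).
move=> /(_ _ _)/ae_eqe_mul2l; apply.
- exact/measurable_EFinP.
- by move=> E _ mE; rewrite -Radon_Nikodym_SigmaFinite.f_integral//; exact: Pf.
Qed.

End density.

Lemma Rintegral_gt0 d (T : measurableType d) (R : realType)
    (mu : {measure set T -> \bar R}) (f : T -> R) :
  mu.-integrable setT (EFin \o f) -> (forall x, 0 <= f x) ->
  ~ {ae mu, forall x, f x = 0} -> 0 < \int[mu]_x f x.
Proof.
move=> fi f0 nf; rewrite lt_neqAle Rintegral_ge0// andbT; apply/eqP => I0.
apply: nf; have mf := measurable_int _ fi.
have : (\int[mu]_x `|(EFin \o f) x| = 0)%E.
  under eq_integral do rewrite gee0_abs ?lee_fin//.
  by rewrite -[LHS]fineK; [congr EFin|exact: integrable_fin_num].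
by move/(ae_eq_integral_abs _ measurableT mf); apply: filterS => x /(_ I) [].
Qed.

(** * Scalar products are not almost everywhere constant *)

Section nonconstant.
Context {R : realType} {n : nat}.
Local Notation S := (sphere R n).
Local Notation mu := (@surface_measure R n).

Lemma integrable_bounded (f : S -> R) (M : R) : measurable_fun setT f ->
  (forall x, `|f x| <= M) -> mu.-integrable setT (EFin \o f).
Proof.
move=> mf fM; apply: measurable_bounded_integrable => //.
  exact: surface_measureT_fin.
exists M; split; first exact: num_real.
by move=> y My x _; exact: le_trans (fM x) (ltW My).
Qed.

Lemma ae_rotate (O : 'M[R]_n.+1) (OO : O^T *m O = 1%:M) (P : S -> Prop) :
  {ae mu, forall x, P x} -> {ae mu, forall x, P (rotate OO x)}.
Proof.
move=> [A [mA A0 PA]]; exists (rotate OO @^-1` A); split.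
- by rewrite -[X in measurable X]setTI; exact: measurable_rotate.
- by rewrite surface_measure_rotate.
- by move=> x Px; exact: PA.
Qed.

(** The sign [s] is [1] or [-1]: both [e_i] and [- e_i] are used as poles. *)
Lemma basis_subproof (s : R) (i : 'I_n.+1) : s ^+ 2 = 1 ->
  dot (s *: delta_mx i 0 : 'cV[R]_n.+1) (s *: delta_mx i 0) == 1.
Proof.
move=> s1; rewrite dotZ -expr2 s1 mul1r dotE (bigD1 i)//= big1 => [|j /negPf ji].
  by rewrite !mxE !eqxx mulr1 addr0.
by rewrite !mxE ji mul0r.
Qed.

Lemma dot_basis (x : 'cV[R]_n.+1) (s : R) (i : 'I_n.+1) :
  dot x (s *: delta_mx i 0) = s * x i 0.
Proof.
rewrite -[x]scale1r dotZ mul1r scale1r dotE (bigD1 i)//= big1 => [|j /negPf ji].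
  by rewrite !mxE !eqxx mulr1 addr0.
by rewrite !mxE ji mulr0.
Qed.

(** By reflection the constant is the same for every pole.  Opposite poles force
it to vanish, and then the poles [e_i] force all coordinates of almost every
point to vanish, which no point of the sphere does. *)
Lemma dot_nonconstant (y : S) (a : R) : ~ {ae mu, forall x : S, dot x y = a}.
Proof.
move=> xya.
have xza (z : S) : {ae mu, forall x : S, dot x z = a}.
  have := ae_rotate (householder_orth (z : 'cV_n.+1) y) xya.
  by apply: filterS => x <-; rewrite dot_reflect.
have coord0 (i : 'I_n.+1) : {ae mu, forall x : S, sphere_val x i 0 = 0}.
  have p : (1 : R) ^+ 2 = 1 by rewrite expr1n.
  have m : (-1 : R) ^+ 2 = 1 by rewrite sqrrN expr1n.
  move: (xza (Sphere (basis_subproof i p))) (xza (Sphere (basis_subproof i m))).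
  apply: filterS2 => x; rewrite /= !dot_basis => *; lra.
have : {ae mu, forall x : S, False}.
  have := ae_foralln (fun k => coord0 (inord k)); apply: filterS => x x00.
  have := dot_sphere x; rewrite dotE big1 => [/esym/eqP|i _].
    by rewrite oner_eq0.
  by have := x00 i; rewrite inord_val => ->; rewrite mul0r.
move=> [A [mA A0 TA]].
have /eqP : mu setT = 0.
  by rewrite -A0; congr (mu _); apply/seteqP; split=> // x _; apply: TA => /=; apply.
by rewrite gt_eqF// surface_measureT_gt0.
Qed.

End nonconstant.

(** * Expected distances *)

Section moments.
Context {R : realType} {n : nat}.
Local Notation S := (sphere R n).
Local Notation mu := (@surface_measure R n).
Variable delta : R -> R.
Hypothesis delta_ge0 : forall t, -1 <= t <= 1 -> 0 <= delta t.
Hypothesis delta_decr :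
  forall s t, -1 <= s -> s < t -> t <= 1 -> delta t < delta s.
Implicit Types (f : R -> R) (x y z : S).

Lemma delta_noninc s t : -1 <= s -> s <= t -> t <= 1 -> delta t <= delta s.
Proof.
move=> s1; rewrite le_eqVlt => /predU1P[->//|st] t1.
exact/ltW/delta_decr.
Qed.

Lemma delta_dot_ge0 x y : 0 <= delta (dot x y).
Proof. exact/delta_ge0/dot_itv. Qed.

(** Monotonicity of [delta] is only known on [[-1, 1]], so its argument is clipped
to that interval to get a function monotone on the line. *)
Lemma measurable_delta_dot y : measurable_fun setT (fun x => delta (dot x y)).
Proof.
pose g t := - delta (Num.max (-1) (Num.min t 1)).
have mg : measurable_fun setT g.
  apply: nondecreasing_measurable => // s t st.
  rewrite lerN2; apply: delta_noninc.
  - by rewrite le_max lexx.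
  - by rewrite ge_max !le_max lexx /= le_min !ge_min st lexx !orbT.
  - by rewrite ge_max ge_min lexx orbT andbT; lra.
rewrite (_ : (fun x : S => _) = (fun x : S => - g (dot x y))).
  exact: measurableT_comp (measurableT_comp mg (measurable_dot y)).
apply/funext => x; rewrite /g opprK; have /andP[a b] := dot_itv x y.
by rewrite min_l// max_r.
Qed.

Lemma measurable_nondecreasing_dot f y : {homo f : s t / s <= t} ->
  measurable_fun setT (fun x => f (dot x y)).
Proof.
move=> f_nd; apply: (measurableT_comp _ (measurable_dot y)).
exact: nondecreasing_measurable.
Qed.

Lemma integrable_nondecreasing_dot f y : (forall t, 0 <= f t) ->
  {homo f : s t / s <= t} -> mu.-integrable setT (EFin \o (fun x => f (dot x y))).
Proof.
move=> f0 f_nd; apply: (@integrable_bounded _ _ _ (f 1)).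
  exact: measurable_nondecreasing_dot.
by move=> x; rewrite ger0_norm// f_nd//; have /andP[] := dot_itv x y.
Qed.

Lemma measurable_delta_weight f y z : {homo f : s t / s <= t} ->
  measurable_fun setT (fun x => delta (dot x y) * f (dot x z)).
Proof.
move=> f_nd; apply: measurable_funM; first exact: measurable_delta_dot.
exact: measurable_nondecreasing_dot.
Qed.

Lemma integrable_delta_weight f y z : (forall t, 0 <= f t) ->
  {homo f : s t / s <= t} ->
  mu.-integrable setT (EFin \o (fun x => delta (dot x y) * f (dot x z))).
Proof.
move=> f0 f_nd; apply: (@integrable_bounded _ _ _ (delta (-1) * f 1)).
  exact: measurable_delta_weight.
move=> x; rewrite ger0_norm ?mulr_ge0 ?delta_dot_ge0//.
have /andP[yN1 y1] := dot_itv x y; have /andP[_ z1] := dot_itv x z.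
by rewrite ler_pM ?delta_dot_ge0 ?f_nd// delta_noninc.
Qed.

(** Up to normalization, the expected distance to [y] under the rotationally
symmetric distribution with pole [z] and profile [f]. *)
Definition moment f y z : R := \int[mu]_x (delta (dot x y) * f (dot x z)).

Section rearrangement.
Variable f : R -> R.
Hypothesis f_ge0 : forall t, 0 <= f t.
Hypothesis f_nd : {homo f : s t / s <= t}.

(** Both follow from the invariance of the surface measure under the reflection
exchanging [y] and [z]. *)
Lemma moment_reflect y z :
  moment f y z = moment f z y /\ moment f y y = moment f z z.
Proof.
have OO := householder_orth (y : 'cV[R]_n.+1) z.
have rotE w : moment f w z = \int[mu]_x
    (delta (dot (rotate OO x) w) * f (dot (rotate OO x) z)).
  apply/esym.
  apply: (Rintegral_rotate OO (f := fun x => delta (dot x w) * f (dot x z))).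
    exact: measurable_delta_weight.
  by move=> x; rewrite mulr_ge0// delta_dot_ge0.
split; rewrite rotE; apply: eq_Rintegral => x _ /=; rewrite !dot_reflect//.
by rewrite householderC dot_reflect.
Qed.

(** By [moment_reflect], adding to each side its copy with [y] and [z] exchanged
doubles it; the difference of the resulting integrands is
[(delta s - delta t) * (f s - f t) <= 0], with [s] and [t] the two scalar
products. *)
Lemma moment_min y z : moment f z z <= moment f y z.
Proof.
have [yz yy] := moment_reflect y z.
suff : moment f y y + moment f z z <= moment f z y + moment f y z.
  by rewrite yy -yz; lra.
have int := integrable_delta_weight _ _ f_ge0 f_nd.
rewrite /moment -!RintegralD ?int//.
apply: le_Rintegral => //.
- exact: integrableD (int _ _) (int _ _).
- exact: integrableD (int _ _) (int _ _).
move=> x _.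
wlog ab : y z {yz yy} / dot x y <= dot x z => [W|].
  have [|/ltW] := leP (dot x y) (dot x z); first exact: W.
  by move/W; rewrite addrC [X in _ <= X]addrC.
have /andP[y1 _] := dot_itv x y; have /andP[_ z1] := dot_itv x z.
have := mulr_ge0 (_ : 0 <= delta (dot x y) - delta (dot x z))
  (_ : 0 <= f (dot x z) - f (dot x y)).
by rewrite !subr_ge0 => /(_ (delta_noninc y1 ab z1) (f_nd ab)); lra.
Qed.

End rearrangement.

(** Since [f1] and [f2] have the same integral, the constant [delta u0] may be
subtracted from [delta]; then [(f2 - f1) * (delta u0 - delta)] is positive
on both sides of the latitude [u0], where [f1] and [f2] cross. *)
Lemma moment_lt f1 f2 z u0 : (forall t, 0 <= f1 t) -> (forall t, 0 <= f2 t) ->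
  {homo f1 : s t / s <= t} -> {homo f2 : s t / s <= t} ->
  \int[mu]_x f1 (dot x z) = \int[mu]_x f2 (dot x z) ->
  -1 <= u0 <= 1 ->
  (forall u, -1 <= u <= 1 -> u < u0 -> f2 u < f1 u) ->
  (forall u, -1 <= u <= 1 -> u0 < u -> f1 u < f2 u) ->
  moment f2 z z < moment f1 z z.
Proof.
move=> f10 f20 f1_nd f2_nd f12 /andP[u0N1 u01] lt_cr gt_cr.
have i1 := integrable_nondecreasing_dot z f10 f1_nd.
have i2 := integrable_nondecreasing_dot z f20 f2_nd.
have d1 := integrable_delta_weight z z f10 f1_nd.
have d2 := integrable_delta_weight z z f20 f2_nd.
have iZ f : mu.-integrable setT (EFin \o (fun x => f (dot x z))) ->
    mu.-integrable setT (EFin \o (fun x => delta u0 * f (dot x z))).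
  by move=> fi; exact: (integrableZl measurableT (delta u0) fi).
pose g x := delta u0 * f2 (dot x z) - delta u0 * f1 (dot x z) +
  (delta (dot x z) * f1 (dot x z) - delta (dot x z) * f2 (dot x z)).
have gE x : g x = (f2 (dot x z) - f1 (dot x z)) * (delta u0 - delta (dot x z)).
  by rewrite /g; ring.
have g_gt0 x : dot x z != u0 -> 0 < g x.
  have xz := dot_itv x z; have /andP[xzN1 xz1] := xz.
  rewrite gE neq_lt => /orP[xu|xu].
    rewrite nmulr_rgt0 ?subr_lt0; [exact: delta_decr|exact: lt_cr].
  rewrite mulr_gt0// subr_gt0; [exact: gt_cr|exact: delta_decr].
have g1 : mu.-integrable setT (EFin \o
    (fun x => delta u0 * f2 (dot x z) - delta u0 * f1 (dot x z))).
  exact: (integrableB measurableT (iZ f2 i2) (iZ f1 i1)).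
have g2 : mu.-integrable setT (EFin \o
    (fun x => delta (dot x z) * f1 (dot x z) - delta (dot x z) * f2 (dot x z))).
  exact: (integrableB measurableT d1 d2).
suff : 0 < \int[mu]_x g x.
  rewrite RintegralD// RintegralB ?iZ// RintegralB// !RintegralZl//.
  by rewrite f12 subrr add0r subr_gt0.
apply: Rintegral_gt0 => [|x|g0].
- exact: (integrableD measurableT g1 g2).
- have [xu|/g_gt0/ltW//] := eqVneq (dot x z) u0.
  by rewrite gE xu subrr mulr0.
apply: (@dot_nonconstant _ _ z u0); apply: filterS g0 => x gx0.
by apply/eqP/negPn/negP => /g_gt0; rewrite gx0 ltxx.
Qed.

End moments.

Section normalized.
Context {R : realType} {n : nat}.
Local Notation S := (sphere R n).
Local Notation mu := (@surface_measure R n).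
Variables (f : R -> R) (z : S) (P : probability S R).
Hypothesis f_ge0 : forall t, 0 <= f t.
Hypothesis f_nd : {homo f : s t / s <= t}.

Lemma normalizer_gt0 (c : R) : has_density P (fun x => c * f (dot x z)) -> 0 < c.
Proof.
move=> Pf; have : c * \int[mu]_x f (dot x z) = 1.
  rewrite -RintegralZl//; last exact: integrable_nondecreasing_dot.
  by rewrite /Rintegral -Pf// probability_setT.
have I0 : 0 <= \int[mu]_x f (dot x z) by exact: Rintegral_ge0.
move=> cI; rewrite ltNge; apply/negP => c0; have := mulr_le0_ge0 c0 I0.
by rewrite cI ler10.
Qed.

Hypothesis P_density : has_density P (fun x => f (dot x z)).

Lemma density_mass : \int[mu]_x f (dot x z) = 1.
Proof. by rewrite /Rintegral -P_density// probability_setT. Qed.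

Lemma fine_expectation_dist delta y :
  (forall t, -1 <= t <= 1 -> 0 <= delta t) ->
  (forall s t, -1 <= s -> s < t -> t <= 1 -> delta t < delta s) ->
  fine 'E_P[dist_of delta y] = moment delta f y z.
Proof.
move=> delta_ge0 delta_decr.
have -> : dist_of delta y = (fun x => delta (dot x y)).
  by apply/funext => x; rewrite /dist_of dotC.
rewrite (expectation_density _ P_density)//.
- exact: measurable_nondecreasing_dot.
- exact: measurable_delta_dot.
- by move=> x; exact: delta_dot_ge0.
Qed.

End normalized.

(** * Maximal depth *)

Theorem theorem4 (R : realType) (q : nat) (q_ge2 : (2 <= q)%N)
  (delta : R -> R)
  (delta_ge0 : forall t, -1 <= t <= 1 -> 0 <= delta t)
  (delta_decr : forall s t, -1 <= s -> s < t -> t <= 1 -> delta t < delta s)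
  (delta_dist : is_distance (dist_of delta : sphere R q.-1 -> _ -> R))
  (delta_rot : rotation_invariant (dist_of delta : sphere R q.-1 -> _ -> R))
  (theta0 : sphere R q.-1)
  (h : R -> R)
  (h_ge0 : forall t, 0 <= h t)
  (h_incr : {homo h : s t / s < t})
  (h_derivable : forall t, derivable h t 1)
  (h_log : {homo (fun t => t * derive1 (fun u => ln (h u)) t) : s t / s < t})
  (c : R -> R) (H : R -> probability (sphere R q.-1) R)
  (H_density : forall kappa, 0 < kappa ->
    has_density (H kappa) (fun x => c kappa * h (kappa * dot x theta0))) :
  (forall kappa, 0 < kappa -> forall theta,
    depth (dist_of delta) theta (H kappa)
      <= depth (dist_of delta) theta0 (H kappa)) /\
  (forall kappa1 kappa2, 0 < kappa1 -> kappa1 < kappa2 ->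
    depth (dist_of delta) theta0 (H kappa1)
      < depth (dist_of delta) theta0 (H kappa2)).
Proof.
have h_nd : {homo h : s t / s <= t} by exact: ltW_homo.
have hk_ge0 k t : 0 <= h (k * t) by [].
have hk_nd k : 0 < k -> {homo (fun u => h (k * u)) : s t / s <= t}.
  by move=> k0 s t st; rewrite h_nd// ler_pM2l.
have c_gt0 k : 0 < k -> 0 < c k.
  move=> k0; apply: (@normalizer_gt0 _ _ (fun u => h (k * u)) theta0 (H k)
    (hk_ge0 k) (hk_nd k k0) (c k) (H_density k k0)).
pose f k u := c k * h (k * u).
have f_ge0 k : 0 < k -> forall t, 0 <= f k t.
  by move=> k0 t; rewrite mulr_ge0// ltW ?c_gt0.
have f_nd k : 0 < k -> {homo f k : s t / s <= t}.
  by move=> k0 s t st; rewrite ler_pM2l ?c_gt0// hk_nd.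
have H_f k : 0 < k -> has_density (H k) (fun x => f k (dot x theta0)).
  exact: H_density.
have EE k theta : 0 < k ->
    fine 'E_(H k)[dist_of delta theta] = moment delta (f k) theta theta0.
  by move=> k0; apply: fine_expectation_dist => //; [exact: f_nd|exact: H_f].
split=> [k k0 theta|k1 k2 k10 k12]; rewrite /depth.
  by rewrite lerB// !EE//; apply: moment_min => //; [exact: f_ge0|exact: f_nd].
have k20 := lt_trans k10 k12.
have [u0 u01 cross] := density_crossing h_ge0 h_incr h_derivable h_log
  (c_gt0 _ k10) (c_gt0 _ k20) k10 k12.
rewrite ltrD2l ltrN2 !EE//.
apply: (moment_lt delta_ge0 delta_decr (u0 := u0)) => //;
  try exact: f_ge0; try exact: f_nd.
- by rewrite !(density_mass (H_f _ _)).
- by move=> u /cross[].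
- by move=> u /cross[].
Qed.
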